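(* Let $f(x)=\tfrac12x^{\mathsf T}Qx+q^{\mathsf T}x$ with $Q=Q^{\mathsf T}$ (possibly indefinite), and suppose that $\mathcal L(x^0):=\Omega\cap\{x\in\mathbb R^n: f(x)\le f(x^0)\}$ is compact. Let $\{x^k\}$ be generated by the thresholded branch trust-region algorithm (TBTA) described in the context, with fixed $\tau>0$ and $\Delta_{\min}>0$. (i) If the algorithm terminates, its returned point is B-stationary for $\min_{x\in\Omega}f(x)$. (ii) If the iteration is infinite, then $\{x^k\}$ has accumulation points and, with probability one, every accumulation point of $\{x^k\}$ is B-stationary for $\min_{x\in\Omega}f(x)$.
   Context: Let $n_0\ge0$, $m\ge1$ be integers, $n=n_0+2m$, and write $x=(x_0,x_1,x_2)\in\mathbb R^{n_0}\times\mathbb R^m\times\mathbb R^m$ for $x\in\mathbb R^n$. Fix matrices $A,B$ and vectors $a,b$ of compatible dimensions; vector inequalities are componentwise, $[m]=\{1,\dots,m\}$, $\|\cdot\|$ is the Euclidean norm. The feasible set is $\Omega=\{x: Ax-a=0,\ Bx-b\ge0,\ x_1\ge0,\ x_2\ge0,\ x_{1,i}x_{2,i}=0\ \forall i\in[m]\}$. Labels and branches: $\mathcal P$ is the set of the $2^m$ ordered pairs $J=(D_1,D_2)$ with $D_1\cup D_2=[m]$, $D_1\cap D_2=\varnothing$; $\Omega_J=\{x: Ax-a=0,\ Bx-b\ge0,\ x_{1,i}=0,\,x_{2,i}\ge0\ (i\in D_1),\ x_{1,i}\ge0,\,x_{2,i}=0\ (i\in D_2)\}$. For $z=(z_0,z_1,z_2)$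 with $z_1,z_2\ge0$ and $z_{1,i}z_{2,i}=0$ for all $i$, let $\mathcal I_{+0}(z)=\{i:z_{1,i}>0,z_{2,i}=0\}$, $\mathcal I_{0+}(z)=\{i:z_{1,i}=0,z_{2,i}>0\}$, $\mathcal I_{00}(z)=\{i:z_{1,i}=z_{2,i}=0\}$, and $\mathcal P(z)=\{(D_1,D_2)\in\mathcal P:\mathcal I_{0+}(z)\subseteq D_1,\ \mathcal I_{+0}(z)\subseteq D_2\}$. Tangent cone of $S$ at $\bar x\in S$: $T_S(\bar x)=\{d:\exists\,t_\ell\downarrow0,\ d^\ell\to d,\ \bar x+t_\ell d^\ell\in S\}$. A point $\bar x\in\Omega$ is B-stationary for $\min_\Omega f$ if $\nabla f(\bar x)^{\mathsf T}d\ge0$ for all $d\in T_\Omega(\bar x)$. Thresholding: for $\tau>0$ and $x\in\Omega$, $\mathcal S_\tau(x)=\{i\notin\mathcal I_{00}(x):\|(x_{1,i},x_{2,i})\|\le\tau\}$; $T_\tau(x)$ is the vector with $(T_\tau(x))_0=x_0$ and, for $j=1,2$, $(T_\tau(x))_{j,i}=0$ if $i\in\mathcal S_\tau(x)$, $=x_{j,i}$ otherwise. Branch LP: for $y\in\mathbb R^n$, $J\in\mathcal P$, $\delta>0$, $\mathrm{LP}(y,J,\delta)$ is $\min_d\{\nabla f(y)^{\mathsf T}d: y+d\in\Omega_J,\ \|d\|_\infty\le\delta\}$. Subroutine LBTRS with constants $0<\eta_1\le\eta_2<1$, $0<\gamma_{\rm dec}<1<\gamma_{\rm inc}$, $\Delta_{\min}>0$;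 input $(y,J,\delta_0)$ with $y\in\mathbb R^n$, $J\in\mathcal P$, $\delta_0\ge\Delta_{\min}$. For $\ell=0,1,2,\dots$: if $\mathrm{LP}(y,J,\delta_\ell)$ is infeasible, return ''failure''. Otherwise take any optimal step $d_\ell$ and set $\mathrm{pred}_\ell=-\nabla f(y)^{\mathsf T}d_\ell$. If $\ell=0$ and $\mathrm{pred}_0=0$, return ''zero''; else if $\mathrm{pred}_\ell\le0$, return ''failure''. Set $\varrho_\ell=(f(y)-f(y+d_\ell))/\mathrm{pred}_\ell$. If $\varrho_\ell\ge\eta_1$, return ''success'' with point $y^+=y+d_\ell$ and radius $\delta^+=\max\{\Delta_{\min},\gamma_{\rm inc}\delta_\ell\}$ if $\varrho_\ell\ge\eta_2$ and $\|d_\ell\|_\infty=\delta_\ell$, and $\delta^+=\max\{\Delta_{\min},\delta_\ell\}$ otherwise. If $\varrho_\ell<\eta_1$, set $\delta_{\ell+1}=\gamma_{\rm dec}\delta_\ell$ and continue. TBTA: input $x^0\in\Omega$, $\Delta_0\ge\Delta_{\min}$, $\tau>0$, and the LBTRS constants. For $k=0,1,2,\dots$: choose $J^k$ conditionally uniformly from $\mathcal P(x^k)$ and apply LBTRS to $(x^k,J^k,\Delta_k)$ (primary search). If it returns ''zero'': if $\mathcal I_{00}(x^k)=\varnothing$, terminate and return $x^k$; otherwise set $(x^{k+1},\Delta_{k+1})=(x^k,\Delta_k)$ and go to iteration $k+1$. Otherwise denote the returned point and radius by $(x_P^k,\Delta_P^k)$, and set $(x_A^k,\Delta_A^k)=(x^k,\Delta_k)$.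 If $\mathcal S_\tau(x^k)\ne\varnothing$, choose $\widehat J^k$ conditionally uniformly from $\mathcal P(T_\tau(x^k))$, apply LBTRS to $(x^k,\widehat J^k,\Delta_k)$ (auxiliary search), and if it returns ''success'' replace $(x_A^k,\Delta_A^k)$ by its returned point and radius. If $f(x_A^k)<f(x_P^k)$ set $(x^{k+1},\Delta_{k+1})=(x_A^k,\Delta_A^k)$; otherwise set $(x^{k+1},\Delta_{k+1})=(x_P^k,\Delta_P^k)$. Probability: all random quantities live on a probability space $(\Xi,\mathcal G,\mathbb P)$ with $\sigma$-algebras $\mathcal F_k^P\subseteq\mathcal F_k^A\subseteq\mathcal F_{k+1}^P$ representing the information immediately before the primary draw and the potential auxiliary draw at iteration $k$. $x^k$ is $\mathcal F_k^P$-measurable; the primary draw and primary-stage computations, the decision whether to perform the auxiliary draw, and $\mathcal P(T_\tau(x^k))$ are $\mathcal F_k^A$-measurable; the auxiliary draw and remaining outputs of iteration $k$ are $\mathcal F_{k+1}^P$-measurable. Conditionally on $\mathcal F_k^P$, $J^k$ is uniform on $\mathcal P(x^k)$; on the event that the auxiliary draw is performed, conditionally on $\mathcal F_k^A$, $\widehat J^k$ is uniform on $\mathcal P(T_\tau(x^k))$. *)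

(* Defs.v *)
From mathcomp Require Import all_boot all_order all_algebra.
From mathcomp Require Import all_classical all_reals all_analysis.
Set Implicit Arguments.
Unset Strict Implicit.
Unset Printing Implicit Defensive.
Import Order.TTheory GRing.Theory Num.Theory.
Import numFieldNormedType.Exports.
Local Open Scope classical_set_scope.
Local Open Scope ring_scope.

Section Calculus.
Variables (R : realType) (n : nat).

Definition dot (u v : 'cV[R]_n) : R := (u^T *m v) 0 0.

Definition grad (f : 'cV[R]_n -> R) (x : 'cV[R]_n) : 'cV[R]_n :=
  \col_i 'D_(delta_mx i 0) f x.

Definition quadratic (Q : 'M[R]_n) (q x : 'cV[R]_n) : R :=
  2^-1 * dot x (Q *m x) + dot q x.

Definition tangent_cone (S : set 'cV[R]_n) (xbar : 'cV[R]_n) : set 'cV[R]_n :=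
  [set d | exists (t : nat -> R) (dl : nat -> 'cV[R]_n),
    [/\ forall l, 0 < t l, t @ \oo --> 0, dl @ \oo --> d
      & forall l, S (xbar + t l *: dl l)]].

Definition B_stationary (f : 'cV[R]_n -> R) (S : set 'cV[R]_n)
    (xbar : 'cV[R]_n) : Prop :=
  S xbar /\ forall d, tangent_cone S xbar d -> 0 <= dot (grad f xbar) d.

End Calculus.

Section Branches.
Variables (R : realType) (n0 m : nat).
Local Notation n := (n0 + (m + m))%N.
Implicit Types x y z : 'cV[R]_n.

Definition part0 x : 'cV[R]_n0 := usubmx x.
Definition part1 x : 'cV[R]_m := usubmx (dsubmx x).
Definition part2 x : 'cV[R]_m := dsubmx (dsubmx x).

Definition label := ({set 'I_m} * {set 'I_m})%type.

Definition labels : {set label} :=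
  [set J : label | (J.1 :|: J.2 == [set: 'I_m]) && (J.1 :&: J.2 == finset.set0)]%SET.

Section FeasibleSets.
Variables (p r : nat) (A : 'M[R]_(p, n)) (a : 'cV[R]_p).
Variables (B : 'M[R]_(r, n)) (b : 'cV[R]_r).

Definition linear_feasible x : Prop :=
  A *m x - a = 0 /\ forall j, 0 <= (B *m x - b) j 0.

Definition Omega : set 'cV[R]_n :=
  [set x | linear_feasible x /\
    forall i, [/\ 0 <= part1 x i 0, 0 <= part2 x i 0
                & part1 x i 0 * part2 x i 0 = 0]].

Definition OmegaJ (J : label) : set 'cV[R]_n :=
  [set x | [/\ linear_feasible x,
    forall i, i \in J.1 -> part1 x i 0 = 0 /\ 0 <= part2 x i 0
    & forall i, i \in J.2 -> 0 <= part1 x i 0 /\ part2 x i 0 = 0]].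

End FeasibleSets.

Definition Ip0 z : {set 'I_m} :=
  [set i | (0 < part1 z i 0) && (part2 z i 0 == 0)]%SET.
Definition I0p z : {set 'I_m} :=
  [set i | (part1 z i 0 == 0) && (0 < part2 z i 0)]%SET.
Definition I00 z : {set 'I_m} :=
  [set i | (part1 z i 0 == 0) && (part2 z i 0 == 0)]%SET.

Definition labels_at z : {set label} :=
  [set J in labels | (I0p z \subset J.1) && (Ip0 z \subset J.2)]%SET.

Definition small_pairs (tau : R) x : {set 'I_m} :=
  [set i | (i \notin I00 x) &&
    (Num.sqrt (part1 x i 0 ^+ 2 + part2 x i 0 ^+ 2) <= tau)]%SET.

Definition threshold (tau : R) x : 'cV[R]_n :=
  col_mx (part0 x)
    (col_mx
      (\col_i (if i \in small_pairs tau x then 0 else part1 x i 0))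
      (\col_i (if i \in small_pairs tau x then 0 else part2 x i 0))).

End Branches.

Record tr_consts (R : realType) := TrConsts {
  eta1 : R; eta2 : R; gamma_dec : R; gamma_inc : R; Delta_min : R }.

Definition tr_consts_ok (R : realType) (c : tr_consts R) : Prop :=
  [/\ 0 < eta1 c <= eta2 c, eta2 c < 1, 0 < gamma_dec c < 1,
      1 < gamma_inc c & 0 < Delta_min c].

(* [Diverges] records a subroutine call whose inner loop never returns. *)
Inductive lbtrs_result (R : realType) (n : nat) :=
| Zero
| Failure
| Success of 'cV[R]_n & R
| Diverges.
Arguments Zero {R n}.
Arguments Failure {R n}.
Arguments Diverges {R n}.

Section LBTRS.
Variables (R : realType) (n0 m p r : nat).
Local Notation n := (n0 + (m + m))%N.
Variables (A : 'M[R]_(p, n)) (a : 'cV[R]_p) (B : 'M[R]_(r, n)) (b : 'cV[R]_r).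
Variables (f : 'cV[R]_n -> R) (c : tr_consts R).
Implicit Types (y d : 'cV[R]_n) (J : label m) (delta : R).

(* The norm of the library on matrices is the maximum norm. *)
Definition lp_feasible y J delta d : Prop :=
  OmegaJ A a B b J (y + d) /\ `|d| <= delta.

Definition lp_optimal y J delta d : Prop :=
  lp_feasible y J delta d /\
  forall d', lp_feasible y J delta d' ->
    dot (grad f y) d <= dot (grad f y) d'.

Definition predicted y d : R := - dot (grad f y) d.

Definition ratio y d : R := (f y - f (y + d)) / predicted y d.

Definition next_radius y delta d : R :=
  if (eta2 c <= ratio y d) && (`|d| == delta)
  then Num.max (Delta_min c) (gamma_inc c * delta)
  else Num.max (Delta_min c) delta.

(* Iteration [l] with radius [delta]: [None] means that the step is rejected
   and the loop continues, [Some o] that the loop returns [o]. *)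
Inductive lbtrs_iter y J (l : nat) delta : option (lbtrs_result R n) -> Prop :=
| IterInfeasible of ~ (exists d, lp_feasible y J delta d) :
    lbtrs_iter y J l delta (Some Failure)
| IterZero d of lp_optimal y J delta d & l = 0%N & predicted y d = 0 :
    lbtrs_iter y J l delta (Some Zero)
| IterNoDecrease d of lp_optimal y J delta d
    & ~ (l = 0%N /\ predicted y d = 0) & predicted y d <= 0 :
    lbtrs_iter y J l delta (Some Failure)
| IterAccept d of lp_optimal y J delta d & 0 < predicted y d
    & eta1 c <= ratio y d :
    lbtrs_iter y J l delta (Some (Success (y + d) (next_radius y delta d)))
| IterReject d of lp_optimal y J delta d & 0 < predicted y d
    & ratio y d < eta1 c :
    lbtrs_iter y J l delta None.

Definition lbtrs y J delta0 (o : lbtrs_result R n) : Prop :=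
  let radius l := gamma_dec c ^+ l * delta0 in
  if o is Diverges then forall l, lbtrs_iter y J l (radius l) None
  else exists l, (forall j, (j < l)%N -> lbtrs_iter y J j (radius j) None) /\
                 lbtrs_iter y J l (radius l) (Some o).

End LBTRS.

(* [Stalled]: no next iterate is defined, because a subroutine call diverged or
   the primary search failed. Nothing is claimed about stalled executions. *)
Inductive status := Running | Returned | Stalled.

Record tbta_state (R : realType) (n : nat) := State {
  stat : status; iterate : 'cV[R]_n; radius : R }.

Section TBTA.
Variables (R : realType) (n0 m p r : nat).
Local Notation n := (n0 + (m + m))%N.
Variables (A : 'M[R]_(p, n)) (a : 'cV[R]_p) (B : 'M[R]_(r, n)) (b : 'cV[R]_r).
Variables (f : 'cV[R]_n -> R) (c : tr_consts R) (tau : R).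
Implicit Types (s : tbta_state R n) (o : lbtrs_result R n).

Definition auxiliary_performed s o : Prop :=
  [/\ stat s = Running, exists y delta, o = Success y delta
    & small_pairs tau (iterate s) != finset.set0].

Definition select_better (xP : 'cV[R]_n) (DP : R) (xA : 'cV[R]_n) (DA : R) :
    tbta_state R n :=
  if f xA < f xP then State Running xA DA else State Running xP DP.

(* The state is frozen once the execution is no longer running. *)
Definition tbta_next s (oP oA : lbtrs_result R n) : tbta_state R n :=
  let: State st x D := s in
  if st isn't Running then s else
  match oP with
  | Zero => State (if I00 x == finset.set0 then Returned else Running) x D
  | Success xP DP =>
      if small_pairs tau x == finset.set0 then select_better xP DP x D
      else match oA with
           | Success xA DA => select_better xP DP xA DA
           | Zero | Failure => select_better xP DP x D
           | Diverges => State Stalled x D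
           end
  | Failure | Diverges => State Stalled x D
  end.

Definition tbta_execution (x0 : 'cV[R]_n) (Delta0 : R)
    (s : nat -> tbta_state R n) (J Jhat : nat -> label m)
    (oP oA : nat -> lbtrs_result R n) : Prop :=
  s 0%N = State Running x0 Delta0 /\
  forall k,
    [/\ stat (s k) = Running ->
          J k \in labels_at (iterate (s k)) /\
          lbtrs A a B b f c (iterate (s k)) (J k) (radius (s k)) (oP k),
        auxiliary_performed (s k) (oP k) ->
          Jhat k \in labels_at (threshold tau (iterate (s k))) /\
          lbtrs A a B b f c (iterate (s k)) (Jhat k) (radius (s k)) (oA k)
      & s k.+1 = tbta_next (s k) (oP k) (oA k)].

End TBTA.

Section Randomness.
Variables (R : realType) (disp : measure_display) (Xi : measurableType disp).
Variable P : probability Xi R.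

Section SubSigmaAlgebra.
Variables (F : set (set Xi)) (D : set Xi).

(* F-measurability, restricted to the event D on which the quantity is used. *)
Definition finite_measurable_on (T : Type) (X : Xi -> T) : Prop :=
  forall t, F (D `&` [set w | X w = t]).

Definition real_measurable_on (X : Xi -> R) : Prop :=
  forall U : set R, measurable U -> F (D `&` [set w | U (X w)]).

Definition state_measurable_on (n : nat) (s : Xi -> tbta_state R n) : Prop :=
  [/\ finite_measurable_on (fun w => stat (s w)),
      forall i, real_measurable_on (fun w => iterate (s w) i 0)
    & real_measurable_on (fun w => radius (s w))].

Definition result_measurable_on (n : nat) (o : Xi -> lbtrs_result R n) : Prop :=
  [/\ F (D `&` [set w | o w = Zero]), F (D `&` [set w | o w = Failure]),
      F (D `&` [set w | o w = Diverges]),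
      forall i (U : set R), measurable U ->
        F (D `&` [set w | exists y delta, o w = Success y delta /\ U (y i 0)])
    & forall U : set R, measurable U ->
        F (D `&` [set w | exists y delta, o w = Success y delta /\ U delta])].

(* On the event D, which belongs to F, the set S is F-measurable and the
   conditional law of X given F is uniform on S; the last clause is the
   defining property of the conditional probabilities P(X = t | F). *)
Definition conditionally_uniform (T : finType) (X : Xi -> T)
    (S : Xi -> {set T}) : Prop :=
  [/\ F D, finite_measurable_on S
    & forall E, F E -> E `<=` D -> forall t : T,
        P (E `&` [set w | X w = t]) =
        (\int[P]_(w in E) ((t \in S w)%:R / #|S w|%:R)%:E)%E].

End SubSigmaAlgebra.

Record tbta_randomness (n0 m : nat) (tau : R)
    (FP FA : nat -> set (set Xi))
    (s : nat -> Xi -> tbta_state R (n0 + (m + m)))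
    (J Jhat : nat -> Xi -> label m)
    (oP oA : nat -> Xi -> lbtrs_result R (n0 + (m + m))) : Prop :=
  TbtaRandomness {
  FP_sigma : forall k, sigma_algebra setT (FP k);
  FA_sigma : forall k, sigma_algebra setT (FA k);
  FP_sub_FA : forall k, FP k `<=` FA k;
  FA_sub_FP : forall k, FA k `<=` FP k.+1;
  FP_events : forall k, FP k `<=` measurable;
  state_meas : forall k, state_measurable_on (FP k) setT (s k);
  primary_draw_meas : forall k,
    finite_measurable_on (FA k) [set w | stat (s k w) = Running] (J k);
  primary_result_meas : forall k,
    result_measurable_on (FA k) [set w | stat (s k w) = Running] (oP k);
  auxiliary_draw_meas : forall k,
    finite_measurable_on (FP k.+1)
      [set w | auxiliary_performed tau (s k w) (oP k w)] (Jhat k);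
  auxiliary_result_meas : forall k,
    result_measurable_on (FP k.+1)
      [set w | auxiliary_performed tau (s k w) (oP k w)] (oA k);
  primary_uniform : forall k,
    conditionally_uniform (FP k) [set w | stat (s k w) = Running]
      (J k) (fun w => labels_at (iterate (s k w)));
  auxiliary_uniform : forall k,
    conditionally_uniform (FA k)
      [set w | auxiliary_performed tau (s k w) (oP k w)]
      (Jhat k) (fun w => labels_at (threshold tau (iterate (s k w)))) }.

End Randomness.

(* Main.v *)
(* Near a feasible point z that is not B-stationary there is a branch J in
   P(z) and an e > 0 such that every trust-region search on J started close
   enough to z, even from a point outside Omega_J, succeeds and lowers f by at
   least e. For iterates x near z the label J belongs to P(T_tau(x)), because
   thresholding removes the small pairs that vanish at z, and to P(x) when no
   pair of x is small. If the iterates visit a neighbourhood of z infinitely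
   often with J in P(x), or with the auxiliary search performed, then by a
   conditional Borel-Cantelli argument J is almost surely drawn infinitely
   often, which contradicts the monotone convergence of the function values.
   Otherwise the primary search eventually always returns "zero" in this
   neighbourhood, so the iterates are eventually constant, equal to z, and then
   J lies in P(x) infinitely often after all. Balls with rational data reduce
   the uncountably many possible z to countably many null events. *)
Require Import Defs.
From mathcomp Require Import all_boot all_order all_algebra.
From mathcomp Require Import all_classical all_reals all_analysis.
From mathcomp Require Import ring lra.
Import Order.TTheory GRing.Theory Num.Theory.
Import numFieldNormedType.Exports.
Local Open Scope classical_set_scope.
Local Open Scope ring_scope.

(** * Quadratic functions *)

Section Quadratics.
Context {R : realType} {n : nat}.
Implicit Types (u v w x d : 'cV[R]_n) (Q : 'M[R]_n).

Lemma dotE u v : dot u v = \sum_i u i 0 * v i 0.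
Proof. by rewrite /dot mxE; apply: eq_bigr => i _; rewrite mxE. Qed.

Lemma dotC u v : dot u v = dot v u.
Proof. by rewrite !dotE; apply: eq_bigr => i _; rewrite mulrC. Qed.

Lemma dotDr u v w : dot u (v + w) = dot u v + dot u w.
Proof. by rewrite /dot mulmxDr mxE. Qed.

Lemma dotZr u (k : R) v : dot u (k *: v) = k * dot u v.
Proof. by rewrite /dot -scalemxAr mxE. Qed.

Lemma dotDl u v w : dot (u + v) w = dot u w + dot v w.
Proof. by rewrite !(dotC _ w) dotDr. Qed.

Lemma dotZl (k : R) u v : dot (k *: u) v = k * dot u v.
Proof. by rewrite !(dotC _ v) dotZr. Qed.

Lemma dot_mulmx_sym Q u v : Q = Q^T -> dot u (Q *m v) = dot (Q *m u) v.
Proof. by move=> Qs; rewrite /dot trmx_mul -Qs mulmxA. Qed.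

Lemma dot_mulmxE Q u v :
  dot u (Q *m v) = \sum_i \sum_j u i 0 * (Q i j * v j 0).
Proof. by rewrite dotE; apply: eq_bigr => i _; rewrite mxE mulr_sumr. Qed.

Lemma coord_le_norm u i : `|u i 0| <= `|u|.
Proof.
rewrite [leRHS]/Num.norm/= mx_normrE.
exact: (le_bigmax _ (fun ij : 'I_n * 'I_1 => `|u ij.1 ij.2|) (i, 0)).
Qed.

Lemma dot_mulmx_bound Q :
  exists2 C : R, 0 < C & forall d, `|dot d (Q *m d)| <= C * `|d| ^+ 2.
Proof.
(* The summand [1] keeps the constant positive even for [Q = 0], so that one may divide by it. *)
exists (\sum_i \sum_j `|Q i j| + 1).
  by apply: ltr_wpDl; rewrite ?ltr01//; apply: sumr_ge0 => i _; apply: sumr_ge0.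
move=> d; apply: (@le_trans _ _ ((\sum_i \sum_j `|Q i j|) * `|d| ^+ 2)); last first.
  by rewrite ler_wpM2r ?sqr_ge0// lerDl.
rewrite dot_mulmxE mulr_suml; apply: le_trans (ler_norm_sum _ _ _) _.
apply: ler_sum => i _; rewrite mulr_suml; apply: le_trans (ler_norm_sum _ _ _) _.
apply: ler_sum => j _; rewrite !normrM mulrCA expr2.
by rewrite ler_wpM2l// ler_pM// coord_le_norm.
Qed.

Lemma quadraticD Q q x d : Q = Q^T ->
  quadratic Q q (x + d) =
  quadratic Q q x + dot (Q *m x + q) d + 2^-1 * dot d (Q *m d).
Proof.
move=> Qs; rewrite /quadratic mulmxDr !dotDr !dotDl (dot_mulmx_sym Q x d Qs).
rewrite (dotC d (Q *m x)).
lra.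
Qed.

Lemma cvg_dot_mulmx {T} {F : set_system T} {FF : Filter F} (Q : 'M[R]_n)
    (u v : T -> 'cV[R]_n) (a b : 'cV[R]_n) :
  u @ F --> a -> v @ F --> b ->
  dot (u t) (Q *m v t) @[t --> F] --> dot a (Q *m b).
Proof.
move=> ua vb; rewrite dot_mulmxE.
under eq_fun do rewrite dot_mulmxE.
have cc (w : T -> 'cV[R]_n) (c : 'cV[R]_n) i : w @ F --> c -> w t i 0 @[t --> F] --> c i 0.
  move=> wc; apply: (@cvg_comp _ _ _ w (fun y : 'cV[R]_n => y i 0) F (nbhs c)).
    exact: wc.
  exact: coord_continuous.
apply: cvg_big => [|i _]; first exact: add_continuous.
apply: cvg_big => [|j _]; first exact: add_continuous.
by apply: cvgM; [exact: cc|apply: cvgM; [exact: cvg_cst|exact: cc]].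
Qed.

Lemma cvg_dot {T} {F : set_system T} {FF : Filter F}
    (u v : T -> 'cV[R]_n) (a b : 'cV[R]_n) :
  u @ F --> a -> v @ F --> b -> dot (u t) (v t) @[t --> F] --> dot a b.
Proof.
move=> ua vb; rewrite -[b]mul1mx; under eq_fun do rewrite -[v _]mul1mx.
exact: cvg_dot_mulmx.
Qed.

Lemma grad_quadratic Q q x : Q = Q^T -> grad (quadratic Q q) x = Q *m x + q.
Proof.
move=> Qs; apply/colP => i; rewrite mxE.
set e := delta_mx i 0.
have -> : (Q *m x + q) i 0 = dot (Q *m x + q) e.
  rewrite dotE (bigD1 i)//= big1 ?addr0; first by rewrite !mxE !eqxx mulr1.
  by move=> j ji; rewrite !mxE (negbTE ji) mulr0.
rewrite /derive; apply: cvg_lim => //.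
set g := dot _ e.
(* For [h != 0] the expansion [quadraticD] turns the difference quotient into this affine function
   of [h], whose limit is its value at [0]. *)
have H : (fun h : R => g + 2^-1 * h * dot e (Q *m e)) @ 0^' -->
    g + 2^-1 * 0 * dot e (Q *m e).
  apply: cvg_within_filter.
  apply: cvgD; first exact: cvg_cst.
  apply: cvgM; last exact: cvg_cst.
  by apply: cvgM; [exact: cvg_cst|exact: cvg_id].
rewrite mulr0 mul0r addr0 in H; apply: cvg_trans H; apply: near_eq_cvg.
near=> h.
have h0 : h != 0 by near: h; exact: nbhs_dnbhs_neq.
rewrite /= (addrC (h *: e)) quadraticD// -scalemxAr !dotZr dotZl -/g /GRing.scale/=.
by field.
Unshelve. all: by end_near. Qed.

Lemma continuous_quadratic Q q : continuous (quadratic Q q).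
Proof.
move=> x.
apply: (@cvgD _ _ _ (nbhs x) _ (fun y => 2^-1 * dot y (Q *m y)) (dot q)).
  apply: (@cvgM _ _ (nbhs x) _ (fun=> 2^-1)); first exact: cvg_cst.
  by apply: (@cvg_dot_mulmx _ (nbhs x) _ Q id id x x); exact: cvg_id.
by apply: (@cvg_dot _ (nbhs x) _ (fun=> q) id q x); [exact: cvg_cst|exact: cvg_id].
Qed.

End Quadratics.

(** * Branches of the feasible set *)

Section Branches.
Context {R : realType} {n0 m p r : nat}.
Local Notation n := (n0 + (m + m))%N.
Context {A : 'M[R]_(p, n)} {a : 'cV[R]_p} {B : 'M[R]_(r, n)} {b : 'cV[R]_r}.
Implicit Types (x y z d : 'cV[R]_n) (J : label m).

Lemma part1E x i : part1 x i 0 = x (rshift n0 (lshift m i)) 0.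
Proof. by rewrite !mxE. Qed.

Lemma part2E x i : part2 x i 0 = x (rshift n0 (rshift m i)) 0.
Proof. by rewrite !mxE. Qed.

(** A branch is cut out by affine equations and inequalities, the complementarity products having
    been replaced by fixed zeros. *)
Lemma OmegaJ_convex J z y (t : R) : 0 <= t <= 1 ->
  OmegaJ A a B b J z -> OmegaJ A a B b J y ->
  OmegaJ A a B b J (z + t *: (y - z)).
Proof.
move=> /andP[t0 t1] [[Az Bz] z1 z2] [[Ay By] y1 y2].
have conv (u v : R) : 0 <= u -> 0 <= v -> 0 <= u + t * (v - u) by nra.
have aff k (M : 'M[R]_(k, n)) (e : 'cV[R]_k) :
    M *m (z + t *: (y - z)) - e = (M *m z - e) + t *: ((M *m y - e) - (M *m z - e)).
  rewrite mulmxDr -scalemxAr mulmxBr; apply/colP => i; rewrite !mxE; ring.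
split.
- split; first by rewrite aff Az Ay subrr scaler0 addr0.
  by move=> j; rewrite aff !mxE; apply: conv; [have := Bz j|have := By j]; rewrite !mxE.
- move=> i iJ; have [z1i z2i] := z1 i iJ; have [y1i y2i] := y1 i iJ.
  rewrite part1E part2E in z1i z2i; rewrite part1E part2E in y1i y2i.
  rewrite part1E part2E !mxE z1i y1i; split; last exact: conv.
  by rewrite subrr mulr0 addr0.
- move=> i iJ; have [z1i z2i] := z2 i iJ; have [y1i y2i] := y2 i iJ.
  rewrite part1E part2E in z1i z2i; rewrite part1E part2E in y1i y2i.
  rewrite part1E part2E !mxE z2i y2i; split; first exact: conv.
  by rewrite subrr mulr0 addr0.
Qed.

Lemma labels_cover J i : J \in labels m -> (i \in J.1) || (i \in J.2).
Proof.
rewrite inE => /andP[/eqP J12 _].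
by rewrite -finset.in_setU J12 inE.
Qed.

Lemma OmegaJ_Omega J x : J \in labels m -> OmegaJ A a B b J x -> Omega A a B b x.
Proof.
move=> Jl [lin x1 x2]; split=> // i.
have /orP[/x1[-> h]|/x2[h ->]] := labels_cover J i Jl.
  by rewrite mul0r.
by rewrite mulr0.
Qed.

Lemma Omega_OmegaJ J x : J \in labels_at x -> Omega A a B b x -> OmegaJ A a B b J x.
Proof.
rewrite !inE => /andP[/andP[_ /eqP J12] /andP[s1 s2]] [lin cx]; split=> // i iJ.
- have [x1 x2 /eqP] := cx i; rewrite mulf_eq0 => /orP[/eqP//|/eqP x20].
  split=> //; move: x1; rewrite le_eqVlt => /predU1P[->//|x1].
  have /(fintype.subsetP s2) i2 : i \in Ip0 x by rewrite inE x1 x20 eqxx.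
  have : i \in J.1 :&: J.2 by rewrite inE iJ i2.
  by rewrite J12 inE.
- have [x1 x2 /eqP] := cx i; rewrite mulf_eq0 => /orP[/eqP x10|/eqP//].
  split=> //; move: x2; rewrite le_eqVlt => /predU1P[->//|x2].
  have /(fintype.subsetP s1) i1 : i \in I0p x by rewrite inE x2 x10 eqxx.
  have : i \in J.1 :&: J.2 by rewrite inE iJ i1.
  by rewrite J12 inE.
Qed.

Lemma labels_at_labels J x : J \in labels_at x -> J \in labels m.
Proof. by rewrite inE => /andP[]. Qed.

Lemma near_coord_gt0 z : \forall x \near z,
  forall i : 'I_n, 0 < z i 0 -> 0 < (x : 'cV[R]_n) i 0.
Proof.
apply: (@filter_forall _ _ (fun i (x : 'cV[R]_n) => 0 < z i 0 -> 0 < x i 0) (nbhs z)) => i.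
case: (ltP 0 (z i 0)) => [z0|_]; last by near=> x.
have : \forall x \near z, 0 < (x : 'cV[R]_n) i 0.
  exact: (@coord_continuous _ _ _ i 0 z) (lt_nbhsr z0).
by apply: filterS => x x0 _.
Unshelve. all: by end_near. Qed.

(** A tangent direction of descent is a limit of directions [dl l] towards feasible points, so some
    [y = z + t l *: dl l] is itself reached by descent. Far enough along the sequence the positive
    coordinates of [z] stay positive at [y], so a label read off the zeros of [y] also fits [z]. *)
Lemma nonstationary_branch (f : 'cV[R]_n -> R) z : Omega A a B b z ->
  ~ B_stationary f (Omega A a B b) z ->
  exists J y, [/\ J \in labels_at z, OmegaJ A a B b J y
    & dot (grad f z) (y - z) < 0].
Proof.
move=> Oz nst.
have [d [[t [dl [t0 tc dc tO]]] gd]] :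
    exists d, tangent_cone (Omega A a B b) z d /\ dot (grad f z) d < 0.
  apply: contrapT => H; apply: nst; split=> // d Td.
  by rewrite leNgt; apply/negP => gd; apply: H; exists d.
have cy : (fun l => z + t l *: dl l) @ \oo --> z.
  rewrite -[X in _ --> X]addr0 -(scale0r d).
  by apply: cvgD; [exact: cvg_cst|exact: cvgZ].
have cg : (fun l => dot (grad f z) (dl l)) @ \oo --> dot (grad f z) d.
  by apply: cvg_dot; [exact: cvg_cst|].
have [l [gl pl]] : exists l, dot (grad f z) (dl l) < 0 /\
    forall i, 0 < z i 0 -> 0 < (z + t l *: dl l) i 0.
  have [l _ /(_ l (leqnn l))//] :
      \forall l \near \oo, dot (grad f z) (dl l) < 0 /\
    forall i, 0 < z i 0 -> 0 < (z + t l *: dl l) i 0.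
    apply: filterI; first exact: cg (lt_nbhsl gd).
    exact: cy (near_coord_gt0 z).
  by exists l.
set y := z + t l *: dl l in pl *.
have [liny Oy] : Omega A a B b y by exact: tO.
(* A pair that vanishes entirely at [y] could go to either side; here it goes to the first. *)
exists ([set i | part1 y i 0 == 0], ~: [set i | part1 y i 0 == 0])%SET, y; split.
- rewrite !inE /= finset.setUCr eqxx finset.setICr eqxx /=; apply/andP; split.
    apply/fintype.subsetP => i; rewrite !inE => /andP[_]; rewrite part2E => /pl.
    rewrite -part2E => y2; have [_ _ /eqP] := Oy i.
    by rewrite mulf_eq0 (gt_eqF y2) orbF.
  apply/fintype.subsetP => i; rewrite !inE => /andP[]; rewrite part1E => /pl.
  by rewrite -part1E => y1 _; rewrite gt_eqF.
- split=> // i; rewrite !inE; have [y1 y2 /eqP] := Oy i.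
    by move=> _ /eqP ->.
  by rewrite mulf_eq0 => /orP[->//|/eqP ->].
- by rewrite /y addrC addKr dotZr pmulr_rlt0.
Qed.

End Branches.

(** * The branch trust-region search *)

Section LBTRS.
Context {R : realType} {n0 m p r : nat}.
Local Notation n := (n0 + (m + m))%N.
Context {A : 'M[R]_(p, n)} {a : 'cV[R]_p} {B : 'M[R]_(r, n)} {b : 'cV[R]_r}.
Context {Q : 'M[R]_n} {q : 'cV[R]_n} {c : tr_consts R}.
Hypotheses (Q_sym : Q = Q^T) (c_ok : tr_consts_ok c).
Local Notation f := (quadratic Q q).
Local Notation lbtrs := (lbtrs A a B b f c).
Local Notation OmegaJ := (OmegaJ A a B b).
Implicit Types (x y z d : 'cV[R]_n) (J : label m) (o : lbtrs_result R n).

Lemma lbtrs_success x J delta0 y delta : lbtrs x J delta0 (Success y delta) ->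
  [/\ OmegaJ J y, f y < f x & Delta_min c <= delta].
Proof.
case: c_ok => /andP[eta_gt0 _] _ _ _ _.
move=> [l [_ it]]; inversion it as [| | |d [[Od _] _] pos acc|]; subst; split=> //.
  have : 0 < Defs.ratio f x d by exact: lt_le_trans acc.
  by rewrite /Defs.ratio pmulr_lgt0 ?invr_gt0// subr_gt0.
by rewrite /next_radius; case: ifP => _; rewrite le_max lexx.
Qed.

(* The competitor [z - x + t (y - z)] is feasible for the branch problem at any
   [x] near [z] as soon as the radius exceeds [t a], where [a] is twice
   [|y - z| + 1]. It predicts a decrease of at least [t v / 2], linear in [t],
   whereas the model error at radius [t a / gamma_dec] is quadratic in [t]; for
   small [t] the step is therefore accepted before the radius drops below
   [t a]. *)
Lemma lbtrs_decrease J z y : OmegaJ J z -> OmegaJ J y ->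
  dot (grad f z) (y - z) < 0 ->
  exists2 e, 0 < e & \forall x \near z, forall delta0 o,
    Delta_min c <= delta0 -> lbtrs x J delta0 o -> o <> Diverges ->
    exists x' delta, o = Success x' delta /\ f x' <= f x - e.
Proof.
case: c_ok => /andP[eta1_gt0 eta12] eta2_lt1 /andP[g0 g1] _ Dm0 Jz Jy.
rewrite grad_quadratic//; set w := y - z => gw.
have eta1_lt1 : eta1 c < 1 by exact: le_lt_trans eta2_lt1.
have [C C0 HC] := dot_mulmx_bound Q.
set v := - dot (Q *m z + q) w; have v0 : 0 < v by rewrite oppr_gt0.
set N := `|w| + 1; have N0 : 0 < N by rewrite ltr_wpDl.
set g := gamma_dec c in g0 g1.
(* Solving [C * (ds / g) ^+ 2 <= (1 - eta1 c) * (t * v)] with [ds = t * (2 * N)] for [t] gives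
   [t <= K]. *)
set K := (1 - eta1 c) * v * g ^+ 2 / (4 * C * N ^+ 2).
have K0 : 0 < K.
  by rewrite divr_gt0// !mulr_gt0// ?exprn_gt0// subr_gt0.
(* The three bounds serve convexity, an initial radius of at least [ds], and the control of the
   model error. *)
pose t := Num.min 1 (Num.min (Delta_min c / (2 * N)) K).
have t0 : 0 < t by rewrite !lt_min ltr01 K0 divr_gt0// mulr_gt0.
have [t1 tD tK] : [/\ t <= 1, t * (2 * N) <= Delta_min c & t <= K].
  rewrite -ler_pdivlMr ?mulr_gt0//.
  by split; rewrite !ge_min lexx ?orbT.
set ds := t * (2 * N).
have ds0 : 0 < ds by rewrite !mulr_gt0.
exists (eta1 c * (t * v / 2)); first by rewrite !mulr_gt0// invr_gt0.
(* The decrease predicted at [x] for the competitor is continuous in [x] and equals [t * v] at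
   [x = z]; half of it therefore survives nearby. *)
have cphi : (fun x => - (dot x (Q *m (z - x + t *: w)) + dot q (z - x + t *: w)))
     @ z --> t * v.
  have -> : t * v = - (dot z (Q *m (z - z + t *: w)) + dot q (z - z + t *: w)).
    rewrite subrr add0r -scalemxAr !dotZr dot_mulmx_sym// -mulrDr -dotDl.
    by rewrite mulrN.
  have cw : (fun x => z - x + t *: w) @ z --> z - z + t *: w.
    apply: (@cvgD _ _ _ (nbhs z) _ (fun x => z - x) (fun=> t *: w)).
      by apply: (@cvgB _ _ _ (nbhs z) _ (fun=> z) id); [exact: cvg_cst|exact: cvg_id].
    exact: cvg_cst.
  apply: (@cvgN _ _ _ (nbhs z) _ (fun x : 'cV[R]_n =>
    dot x (Q *m (z - x + t *: w)) + dot q (z - x + t *: w))).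
  apply: (@cvgD _ _ _ (nbhs z) _ (fun x : 'cV[R]_n =>
    dot x (Q *m (z - x + t *: w))) (fun x => dot q (z - x + t *: w))).
    by apply: (@cvg_dot_mulmx _ _ _ (nbhs z) _ Q id) => //; exact: cvg_id.
  by apply: (@cvg_dot _ _ _ (nbhs z) _ (fun=> q)) => //; exact: cvg_cst.
have tv : t * v / 2 < t * v by rewrite ltr_pdivrMr// ltr_pMr ?mulr_gt0// ltr1n.
have near1 : \forall x \near z,
    t * v / 2 < - (dot x (Q *m (z - x + t *: w)) + dot q (z - x + t *: w)).
  exact: cphi (lt_nbhsr tv).
have near2 : \forall x \near z, `|z - x| < t * N.
  apply: (@cvgr_dist_lt _ _ _ (nbhs z) _ id z); first exact: cvg_id.
  by rewrite mulr_gt0.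
near=> x.
have cand : x + (z - x + t *: w) = z + t *: w by rewrite addrA [x + _]addrC subrK.
have pred_lb delta d : ds <= delta -> lp_optimal A a B b f x J delta d ->
    t * v / 2 <= predicted f x d.
  move=> dsd [_ /(_ (z - x + t *: w))]; rewrite /predicted !grad_quadratic// => opt.
  apply: (@le_trans _ _ (- dot (Q *m x + q) (z - x + t *: w))).
    rewrite dotDl -dot_mulmx_sym//; apply: ltW.
    by near: x.
  rewrite lerN2; apply: opt; split.
    by rewrite cand; apply: OmegaJ_convex => //; rewrite ltW.
  apply: le_trans dsd; apply: le_trans (ler_normD _ _) _.
  rewrite normrZ gtr0_norm//.
  have zx : `|z - x| < t * N by near: x.
  have tw : t * `|w| <= t * N by rewrite ler_pM2l// lerDl.
  rewrite /ds; nra.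
(* The actual decrease differs from the predicted one by half of [dot d (Q *m d)], which in this
   range of radii is at most [1 - eta1 c] times the prediction. *)
have acc delta d : ds <= delta -> delta <= ds / g ->
    lp_optimal A a B b f x J delta d -> eta1 c <= Defs.ratio f x d.
  move=> d1 d2 opt; have plb := pred_lb _ _ d1 opt.
  case: opt => -[_ dd] _.
  have tv0 : 0 < t * v / 2 by rewrite !mulr_gt0// invr_gt0.
  have p0 : 0 < predicted f x d by exact: lt_le_trans plb.
  rewrite /Defs.ratio ler_pdivlMr// quadraticD//.
  have -> : dot (Q *m x + q) d = - predicted f x d.
    by rewrite /predicted opprK grad_quadratic.
  have quad : dot d (Q *m d) <= C * (ds / g) ^+ 2.
    apply: le_trans (ler_norm _) _; apply: le_trans (HC d) _.
    rewrite ler_pM2l// ler_sqr ?nnegrE// ?(le_trans dd)//.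
    by rewrite divr_ge0 ?ltW.
  have small : C * (ds / g) ^+ 2 <= (1 - eta1 c) * (t * v).
    have -> : C * (ds / g) ^+ 2 = t * (t * (4 * C * N ^+ 2)) / g ^+ 2.
      by rewrite /ds; field; rewrite gt_eqF.
    rewrite ler_pdivrMr ?exprn_gt0//.
    have -> : (1 - eta1 c) * (t * v) * g ^+ 2 = t * ((1 - eta1 c) * v * g ^+ 2) by ring.
    rewrite ler_pM2l// -ler_pdivlMr//.
    by rewrite !mulr_gt0// exprn_gt0.
  nra.
(* A rejected radius must exceed [ds / g], so one reduction by [g] cannot bring it below [ds]. By
   induction [ds] bounds every radius of the loop from below. *)
have rej l delta : ds <= delta ->
    lbtrs_iter A a B b f c x J l delta None -> ds <= g * delta.
  move=> dsd it; inversion it as [| | | |d opt pos rat]; subst.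
  rewrite mulrC -ler_pdivrMr//; rewrite leNgt; apply/negP => /ltW ds'.
  by move: rat; rewrite ltNge (acc delta d).
move=> delta0 o d0 lb oD.
have {lb oD} [l [rejs it]] : exists l,
    (forall j, (j < l)%N -> lbtrs_iter A a B b f c x J j (g ^+ j * delta0) None)
      /\ lbtrs_iter A a B b f c x J l (g ^+ l * delta0) (Some o).
  by case: o lb oD.
have dsl : ds <= g ^+ l * delta0.
  elim: l rejs {it} => [_|l IH rejs]; first by rewrite expr0 mul1r (le_trans tD).
  rewrite exprS -mulrA; apply: (rej l); last exact: rejs.
  by apply: IH => j jl; apply: rejs; rewrite ltnS ltnW.
have tv0 : 0 < t * v / 2 by rewrite !mulr_gt0// invr_gt0.
inversion it as [nf|d opt _ p0|d opt _ p0|d opt p0 ra|]; subst.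
- exfalso; apply: nf.
  exists (z - x + t *: w); split.
    by rewrite cand; apply: OmegaJ_convex => //; rewrite ltW.
  apply: le_trans dsl; apply: le_trans (ler_normD _ _) _.
  rewrite normrZ gtr0_norm//.
  have zx : `|z - x| < t * N by near: x.
  have tw : t * `|w| <= t * N by rewrite ler_pM2l// lerDl.
  rewrite /ds; nra.
- have := pred_lb _ _ dsl opt; rewrite p0; lra.
- have := pred_lb _ _ dsl opt; lra.
- do 2!eexists; split; first by reflexivity.
  have plb := pred_lb _ _ dsl opt.
  move: ra; rewrite /Defs.ratio ler_pdivlMr// => ra.
  have : eta1 c * (t * v / 2) <= eta1 c * predicted f x d by rewrite ler_pM2l.
  lra.
Unshelve. all: by end_near. Qed.

End LBTRS.

(** * Conditional Borel-Cantelli *)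

Section SigmaAlgebra.
Context {T : Type} {G : set (set T)}.
Hypothesis sG : sigma_algebra setT G.

Lemma sigma_algebra_setT : G setT.
Proof. by case: sG => G0 GC _; rewrite -(setD0 setT); exact: GC. Qed.

Lemma sigma_algebra_setC X : G X -> G (~` X).
Proof. by case: sG => _ GC _ GX; rewrite -setTD; exact: GC. Qed.

Lemma sigma_algebra_forall (X : nat -> set T) :
  (forall i, G (X i)) -> G [set w | forall i, X i w].
Proof.
case: (sG) => _ _ GU GX.
have -> : [set w | forall i, X i w] = ~` \bigcup_i ~` X i.
  rewrite setC_bigcup; apply/seteqP; split => w /= h i.
    by move=> _; rewrite setCK.
  by have := h i I; rewrite setCK.
by apply/sigma_algebra_setC/GU => i; exact: sigma_algebra_setC.
Qed.

Lemma sigma_algebra_setI X Y : G X -> G Y -> G (X `&` Y).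
Proof.
move=> GX GY.
have -> : X `&` Y = [set w | forall i, (if i is 0%N then X else Y) w].
  apply/seteqP; split => w /= h; last by split; [exact: h 0%N|exact: h 1%N].
  by case: h => hX hY [].
by apply: sigma_algebra_forall => -[].
Qed.

Lemma sigma_algebra_exists_countable (I : countType) (X : I -> set T) :
  (forall i, G (X i)) -> G [set w | exists i, X i w].
Proof.
case: (sG) => G0 _ GU GX.
have -> : [set w | exists i, X i w] =
    \bigcup_k (if unpickle k is Some i then X i else set0).
  apply/seteqP; split => w /=; first by move=> [i Xi]; exists (pickle i); rewrite ?pickleK.
  by move=> [k _]; case: unpickle => [i Xi|//]; exists i.
by apply: GU => k; case: unpickle.
Qed.

Lemma sigma_algebra_forall_countable (I : countType) (X : I -> set T) :
  (forall i, G (X i)) -> G [set w | forall i, X i w].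
Proof.
move=> GX.
have -> : [set w | forall i, X i w] = ~` [set w | exists i, (~` X i) w].
  apply/seteqP; split => w /= h; first by move=> [i]; exact.
  by move=> i; apply: contrapT => Xi; apply: h; exists i.
by apply/sigma_algebra_setC/sigma_algebra_exists_countable => i; exact: sigma_algebra_setC.
Qed.

End SigmaAlgebra.

(** * Events with conditional probability bounded below *)

Section ConditionalBorelCantelli.
Context {R : realType} {disp : measure_display} {T : measurableType disp}.
Variable P : probability T R.

(* The events "V and W hold at time k for the first time after k0" are
   disjoint, so the events "V at time k, and not yet V and W since k0" have
   summable probabilities and the first Borel-Cantelli lemma applies to them. *)
Lemma conditional_borel_cantelli (G : nat -> set (set T)) (V W : nat -> set T)
    (M : R) :
  (forall k, sigma_algebra setT (G k)) ->
  (forall k, G k `<=` G k.+1) -> (forall k, G k `<=` measurable) ->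
  (forall k, G k (V k)) -> (forall k, G k.+1 (V k `&` W k)) -> 0 <= M ->
  (forall k E, G k E -> E `<=` V k -> (P E <= M%:E * P (E `&` W k))%E) ->
  {ae P, forall w, (forall k0, exists2 k, (k0 <= k)%N & V k w) ->
    forall k0, exists2 k, (k0 <= k)%N & V k w /\ W k w}.
Proof.
move=> sG Gle Gm GV GVW M0 PE.
have Gmono i j : (i <= j)%N -> G i `<=` G j.
  move=> /subnK <-; elim: (j - i)%N => [//|l IH]; rewrite addSn.
  by apply: subset_trans IH _; exact: Gle.
have key k0 : {ae P, forall w, (forall k0, exists2 k, (k0 <= k)%N & V k w) ->
    exists2 k, (k0 <= k)%N & V k w /\ W k w}; last first.
  have := ae_foralln key; apply: filterS => w h io k0; exact: h.
pose first k := [set w | forall i, (k0 <= i < k)%N -> ~ (V i w /\ W i w)].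
pose E k := if (k0 <= k)%N then first k `&` V k else set0.
have GE k : G k (E k).
  rewrite /E; case: ifP => // _; last by case: (sG k).
  apply: sigma_algebra_setI => //.
  apply: (sigma_algebra_forall (sG k) (fun i =>
    [set w | (k0 <= i < k)%N -> ~ (V i w /\ W i w)])).
  move=> i; case: (boolP (k0 <= i < k)%N) => [/andP[_ ik]|nik].
    rewrite [X in G k X](_ : _ = ~` (V i `&` W i)).
      by apply: (sigma_algebra_setC (sG k)); exact: (Gmono _ _ ik).
    by apply/seteqP; split => w /= h; [exact: h|move=> _; exact: h].
  rewrite [X in G k X](_ : _ = setT); first exact: (sigma_algebra_setT (sG k)).
  by apply/seteqP; split => w.
have EV k : E k `<=` V k by rewrite /E; case: ifP => // _ w [].
have mE k : measurable (E k) by exact: Gm.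
(* Only the trace of [W k] on [V k] is assumed measurable. *)
have EWE k : E k `&` W k = E k `&` (V k `&` W k).
  by rewrite setIA (setIidl (EV k)).
have mEW k : measurable (E k `&` W k).
  by rewrite EWE; apply: measurableI => //; exact: Gm (GVW k).
have disj : trivIset setT (fun k => E k `&` W k).
  have lt i j w : (i < j)%N -> E i w -> W i w -> ~ E j w.
    move=> ij Ei Wi; rewrite /E; case: ifP => [k0j|_]; last exact.
    move=> [fj _]; apply: (fj i); last by split => //; exact: EV.
    by rewrite ij andbT; move: Ei; rewrite /E; case: ifP.
  apply/trivIsetP => i j _ _ ij; apply/seteqP; split => // w [[Ei Wi] [Ej Wj]].
  case: (ltngtP i j) => [h|h|h]; [exact: (lt i j w)|exact: (lt j i w)|].
  by rewrite h eqxx in ij.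
(* Each [P (E k)] is at most [M] times the probability of a member of a disjoint family, so the sum
   is at most [M]. *)
have sumE : (\sum_(0 <= k <oo) P (E k) < +oo)%E.
  apply: (@le_lt_trans _ _ (M%:E)%E); last exact: ltry.
  apply: (@le_trans _ _ (\sum_(0 <= k <oo) M%:E * P (E k `&` W k))%E).
    apply: lee_nneseries => [k _ _|k _]; first exact: measure_ge0.
    exact: PE.
  rewrite nneseriesZl//.
  have := @measure_bigcup _ _ _ P setT (fun k => E k `&` W k) (fun k _ => mEW k) disj.
  move=> /= h.
  rewrite [X in (_ * X)%E](_ : _ = P (\bigcup_k (E k `&` W k))); last first.
    by rewrite h; apply: eq_eseriesl => k; rewrite in_setT.
  rewrite -[leRHS]mule1; apply: lee_wpmul2l; first by rewrite lee_fin.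
  by apply: probability_le1; exact: bigcup_measurable.
exists (lim_sup_set E); split.
- by apply: bigcap_measurable => // k _; apply: bigcup_measurable.
- exact: lim_sup_set_cvg0.
(* If [V] recurs but never together with [W] after [k0], then every later occurrence of [V] puts [w]
   into [E k]. *)
- move=> w /= /not_implyP[io no] l _.
  have [k lk Vk] := io (maxn k0 l).
  exists k => /=; first exact: leq_trans (leq_maxr _ _) lk.
  have k0k : (k0 <= k)%N by exact: leq_trans (leq_maxl _ _) lk.
  rewrite /E k0k; split => // i /andP[ki _] VW.
  by apply: no; exists i.
Qed.

End ConditionalBorelCantelli.

Lemma ae_forall_countable {R : realType} {disp : measure_display}
    {T : measurableType disp} (mu : {measure set T -> \bar R}) (I : countType)
    (S : I -> T -> Prop) :
  (forall i, {ae mu, forall w, S i w}) -> {ae mu, forall w, forall i, S i w}.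
Proof.
move=> aeS.
have : {ae mu, forall w, forall k, if unpickle k is Some i then S i w else True}.
  by apply: ae_foralln => k; case: unpickle => [i|]; [exact: aeS|exact: aeW].
by apply: filterS => w h i; have := h (pickle i); rewrite pickleK.
Qed.

(** * Uniform draws from random finite sets *)

Section UniformDraws.
Context {R : realType} {disp : measure_display} {Xi : measurableType disp}.
Variable P : probability Xi R.

(** On [E] the conditional probability of drawing [t] is the inverse of the size of [S w], hence at
    least the inverse of the size of [T]; integrate over [E]. *)
Lemma uniform_draw_lower_bound (F : set (set Xi)) (D : set Xi) (T : finType)
    (X : Xi -> T) (S : Xi -> {set T}) (E : set Xi) (t : T) :
  sigma_algebra setT F -> F `<=` measurable ->
  conditionally_uniform P F D X S -> F E -> E `<=` D ->
  (forall w, E w -> t \in S w) ->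
  (P E <= #|T|%:R%:E * P (E `&` [set w | X w = t]))%E.
Proof.
move=> sF Fm [FD FS PX] FE ED tS; rewrite PX//.
have mE := Fm _ FE.
have T0 : (0 < #|T|%:R :> R) by rewrite ltr0n; apply/card_gt0P; exists t.
rewrite -lee_pdivrMl// -integral_cst//.
apply: ge0_le_integral => //.
- by move=> w _; rewrite lee_fin invr_ge0 ltW.
(* The integrand depends on [w] only through [S w], which takes finitely many values, each on an
   event of [F]. *)
- pose h (A : {set T}) : \bar R := (((t \in A)%:R / #|A|%:R)%:E)%E.
  move=> _ Y _.
  have -> : E `&` (fun w => ((t \in S w)%:R / #|S w|%:R)%:E)%E @^-1` Y =
      E `&` [set w | exists A : {set T}, (D `&` [set w | S w = A /\ Y (h A)]) w].
    apply/seteqP; split => w /= [Ew].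
      by move=> Yw; split => //; exists (S w); split => //; exact: ED.
    by move=> [A [_ [<- Yw]]].
  apply: Fm; apply: sigma_algebra_setI => //.
  apply: sigma_algebra_exists_countable => // A.
  have [YA|nYA] := pselect (Y (h A)).
    rewrite [X in F X](_ : _ = D `&` [set w | S w = A]); first exact: FS.
    by apply/seteqP; split => w /= [Dw]; [case|].
  rewrite [X in F X](_ : _ = set0); first by case: sF.
  by apply/seteqP; split => w //= [Dw []].
- move=> w Ew; rewrite lee_fin tS// mul1r lef_pV2 ?posrE//.
    by rewrite ler_nat max_card.
  by rewrite ltr0n; apply/card_gt0P; exists t; exact: tS.
Qed.

(** The lower bound holds with the same constant, the size of [T], at all times, as the conditional
    Borel-Cantelli lemma requires. The events [U k] will locate the iterate in a cube. *)
Lemma uniform_draws_infinitely_often (F : nat -> set (set Xi)) (T : finType)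
    (D U : nat -> set Xi) (X : nat -> Xi -> T) (S : nat -> Xi -> {set T}) (t : T) :
  (forall k, sigma_algebra setT (F k)) ->
  (forall k, F k `<=` F k.+1) -> (forall k, F k `<=` measurable) ->
  (forall k, conditionally_uniform P (F k) (D k) (X k) (S k)) ->
  (forall k, finite_measurable_on (F k.+1) (D k) (X k)) ->
  (forall k, F k (U k)) ->
  {ae P, forall w,
    (forall k0, exists2 k, (k0 <= k)%N & [/\ D k w, U k w & t \in S k w]) ->
    forall k0, exists2 k, (k0 <= k)%N & [/\ D k w, U k w & X k w = t]}.
Proof.
move=> sF Fle Fm cu mX FU.
pose V k := U k `&` [set w : Xi | exists A : {set T},
  (if t \in A then D k `&` [set w | S k w = A] else set0) w].
have VE k w : V k w <-> [/\ D k w, U k w & t \in S k w].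
  split; first by move=> [Uw [A]]; case: ifP => // tA [Dw SA]; split => //; rewrite SA.
  by move=> [Dw Uw tS]; split => //; exists (S k w); rewrite tS.
have FV k : F k (V k).
  apply: sigma_algebra_setI => //; apply: sigma_algebra_exists_countable => // A.
  case: ifP => _; last by case: (sF k).
  by case: (cu k) => _ + _; exact.
have FVW k : F k.+1 (V k `&` [set w | X k w = t]).
  have -> : V k `&` [set w | X k w = t] = V k `&` (D k `&` [set w | X k w = t]).
    apply/seteqP; split => w [] // Vw; last by case=> _ ?; split.
    by move=> Xw; split => //; split => //; move: Vw => /VE[].
  by apply: sigma_algebra_setI => //; [exact: Fle|exact: mX].
have := conditional_borel_cantelli P F V (fun k => [set w | X k w = t]) #|T|%:R
  sF Fle Fm FV FVW (ler0n _ _).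
have h : forall k E, F k E -> E `<=` V k ->
    (P E <= #|T|%:R%:E * P (E `&` [set w | X k w = t]))%E.
  move=> k E FE EV; apply: (@uniform_draw_lower_bound (F k) (D k) _ _ (S k)) => //.
  - by move=> w /EV/VE[].
  - by move=> w /EV/VE[].
move=> /(_ h); apply: filterS => w {}h io k0.
have [|k k0k [/VE[Dw Uw _] Xw]] := h _ k0; last by exists k.
by move=> l; have [k lk /VE ?] := io l; exists k.
Qed.

End UniformDraws.

(** * Labels near a point *)

Section Labels.
Context {R : realType} {n0 m p r : nat}.
Local Notation n := (n0 + (m + m))%N.
Context {A : 'M[R]_(p, n)} {a : 'cV[R]_p} {B : 'M[R]_(r, n)} {b : 'cV[R]_r}.
Implicit Types (x y z d : 'cV[R]_n) (J : label m).

(** Without biactive pairs there is only one branch at [x], so a single [Zero] answer is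
    conclusive. *)
Lemma labels_at_nondegenerate J x : Omega A a B b x -> I00 x = finset.set0 ->
  J \in labels_at x -> J = (I0p x, Ip0 x).
Proof.
move=> [_ Ox] nd; rewrite !inE => /andP[/andP[_ /eqP J12] /andP[s1 s2]].
have dis i : i \in J.1 -> i \in J.2 -> False.
  move=> i1 i2; have : i \in J.1 :&: J.2 by rewrite inE i1.
  by rewrite J12 inE.
have dich i : (i \in I0p x) || (i \in Ip0 x).
  have [x1 x2 /eqP x12] := Ox i; have : i \notin I00 x by rewrite nd inE.
  rewrite !inE !lt0r x1 x2 !andbT; move: x12; rewrite mulf_eq0.
  by case: (part1 x i 0 == 0); case: (part2 x i 0 == 0).
rewrite [LHS]surjective_pairing; congr (_, _); apply/finset.setP => i; apply/idP/idP.
- move=> i1; have /orP[//|/(fintype.subsetP s2) i2] := dich i.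
  by case: (dis i).
- by move/(fintype.subsetP s1).
- move=> i2; have /orP[/(fintype.subsetP s1) i1|//] := dich i.
  by case: (dis i).
- by move/(fintype.subsetP s2).
Qed.

Lemma near_coord_small z (e : R) : 0 < e -> \forall x \near z,
  forall i : 'I_n, z i 0 = 0 -> `|(x : 'cV[R]_n) i 0| < e.
Proof.
move=> e0.
apply: (@filter_forall _ _ (fun i (x : 'cV[R]_n) => z i 0 = 0 -> `|x i 0| < e) (nbhs z)) => i.
case: (pselect (z i 0 = 0)) => [z0|nz]; last by near=> x.
have : \forall x \near z, `|z i 0 - (x : 'cV[R]_n) i 0| < e.
  by apply: (@cvgr_dist_lt _ _ _ (nbhs z) _ (fun x : 'cV[R]_n => x i 0) (z i 0)) => //;
    exact: coord_continuous.
by apply: filterS => x; rewrite z0 sub0r normrN.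
Unshelve. all: by end_near. Qed.

(** A positive coordinate of [x] in a pair whose other entry is zero either is positive at [z],
    where [J] respects it, or vanishes at [z]. In the second case it is below [tau] near [z], so the
    pair is small and thresholding erases it. *)
Lemma near_labels_at J z (tau : R) : 0 < tau -> Omega A a B b z ->
  J \in labels_at z ->
  \forall x \near z, J \in labels_at (threshold tau x) /\
    (small_pairs tau x = finset.set0 -> J \in labels_at x).
Proof.
move=> tau0 [_ Oz]; rewrite inE => /andP[Jl /andP[s1 s2]].
near=> x.
have pos : forall i : 'I_n, 0 < z i 0 -> 0 < x i 0.
  by near: x; exact: near_coord_gt0.
have small : forall i : 'I_n, z i 0 = 0 -> `|x i 0| < tau.
  by near: x; exact: near_coord_small.
have in1 i : i \in I0p x -> (i \in I0p z) || (i \in small_pairs tau x).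
  rewrite !inE => /andP[/eqP x1 x2].
  have [z1 z2 z12] := Oz i.
  move: z2; rewrite le_eqVlt => /predU1P[z2|z2]; last first.
    by move/eqP: z12; rewrite mulf_eq0 (gt_eqF z2) orbF z2 => ->.
  apply/orP; right; rewrite x1 (gt_eqF x2) andbF/= expr0n add0r sqrtr_sqr.
  by rewrite part2E ltW// small// -part2E -z2.
have in2 i : i \in Ip0 x -> (i \in Ip0 z) || (i \in small_pairs tau x).
  rewrite !inE => /andP[x1 /eqP x2].
  have [z1 z2 z12] := Oz i.
  move: z1; rewrite le_eqVlt => /predU1P[z1|z1]; last first.
    by move/eqP: z12; rewrite mulf_eq0 (gt_eqF z1) z1 /= => ->.
  apply/orP; right; rewrite x2 (gt_eqF x1) /= expr0n addr0 sqrtr_sqr.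
  by rewrite part1E ltW// small// -part1E -z1.
have T1 i : part1 (threshold tau x) i 0 =
    if i \in small_pairs tau x then 0 else part1 x i 0.
  by rewrite /part1 /threshold col_mxKd col_mxKu mxE.
have T2 i : part2 (threshold tau x) i 0 =
    if i \in small_pairs tau x then 0 else part2 x i 0.
  by rewrite /part2 /threshold !col_mxKd mxE.
split.
- rewrite inE Jl /=; apply/andP; split; apply/fintype.subsetP => i.
    rewrite inE T1 T2; case: ifP => [|/negbT ns]; first by rewrite ltxx andbF.
    move=> h; apply: (fintype.subsetP s1).
    by have := in1 i; rewrite (negbTE ns) orbF; apply; rewrite inE.
  rewrite inE T1 T2; case: ifP => [|/negbT ns]; first by rewrite ltxx.
  move=> h; apply: (fintype.subsetP s2).
  by have := in2 i; rewrite (negbTE ns) orbF; apply; rewrite inE.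
- move=> s0; rewrite inE Jl /=; apply/andP; split; apply/fintype.subsetP => i.
    by move=> /in1; rewrite s0 finset.in_set0 orbF; exact: (fintype.subsetP s1).
  by move=> /in2; rewrite s0 finset.in_set0 orbF; exact: (fintype.subsetP s2).
Unshelve. all: by end_near. Qed.

End Labels.

(** * A countable neighbourhood base *)

Section RationalCubes.
Context {R : realType} {n : nat}.

(** The parameters form a countable type, and the coordinatewise form reduces measurability to
    single coordinates. The successor keeps the radius positive. *)
Definition rational_cube (C : 'cV[rat]_n * nat) : set 'cV[R]_n :=
  [set x | forall i, ball (ratr (C.1 i 0) : R) C.2.+1%:R^-1 (x i 0)].

Lemma rational_cube_basis (z : 'cV[R]_n) (V : set 'cV[R]_n) : nbhs z V ->
  exists C, rational_cube C `<=` V /\ nbhs z (rational_cube C).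
Proof.
move=> /nbhs_ballP[e /= e0 eV].
have [N Ne] : exists N : nat, N.+1%:R^-1 < e / 2.
  have e20 : 0 < e / 2 by rewrite divr_gt0.
  have [N _ /(_ N (leqnn N))] := near_infty_natSinv_lt (PosNum e20).
  by exists N.
have N0 : 0 < N.+1%:R^-1 :> R by rewrite invr_gt0 ltr0n.
have cl (h : R) : 0 < h -> forall i, exists k : rat, `|z i 0 - ratr k| < h.
  move=> h0 i; have /rat_in_itvoo[k] : z i 0 - h < z i 0 + h by lra.
  rewrite in_itv/= => /andP[k1 k2]; exists k.
  by rewrite ltr_distl; apply/andP; split; lra.
have tri (h u k y : R) : `|u - k| < h -> `|k - y| < h -> h < e / 2 -> `|u - y| < e.
  move=> uk ky he; have -> : u - y = (u - k) + (k - y) by ring.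
  by apply: le_lt_trans (ler_normD _ _) _; lra.
have [c Hc] := choice (cl _ N0).
exists (\col_i c i, N); split.
- move=> x /= Cx; apply: eV; split=> // i j; rewrite !ord1.
  by apply: (tri _ _ (ratr (c i)) _ (Hc i)) => //; have := Cx i; rewrite /ball/= mxE.
- have : \forall x \near z, forall i, ball (ratr (c i) : R) N.+1%:R^-1 ((x : 'cV[R]_n) i 0).
    apply: (@filter_forall _ _ (fun i (x : 'cV[R]_n) =>
      ball (ratr (c i) : R) N.+1%:R^-1 (x i 0)) (nbhs z)) => i.
    apply: (@coord_continuous _ _ _ i 0 z).
    apply: open_nbhs_nbhs; split; first exact: ball_open.
    by rewrite /ball/= distrC.
  by apply: filterS => x xc i /=; rewrite mxE.
Qed.

End RationalCubes.

(** * Executions *)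

Section Execution.
Context {R : realType} {n0 m p r : nat}.
Local Notation n := (n0 + (m + m))%N.
Context {A : 'M[R]_(p, n)} {a : 'cV[R]_p} {B : 'M[R]_(r, n)} {b : 'cV[R]_r}.
Context {Q : 'M[R]_n} {q : 'cV[R]_n} {c : tr_consts R} {tau : R}.
Context {x0 : 'cV[R]_n} {Delta0 : R}.
Context {s : nat -> tbta_state R n} {J Jhat : nat -> label m}.
Context {oP oA : nat -> lbtrs_result R n}.
Local Notation f := (quadratic Q q).
Local Notation Om := (Omega A a B b).
Hypotheses (Q_sym : Q = Q^T) (c_ok : tr_consts_ok c) (tau_gt0 : 0 < tau).
Hypotheses (x0_feasible : Om x0) (Delta0_ge : Delta_min c <= Delta0).
Hypothesis exec : tbta_execution A a B b f c tau x0 Delta0 s J Jhat oP oA.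

Lemma select_better_le (xP xA : 'cV[R]_n) DP DA (st := select_better f xP DP xA DA) :
  f (iterate st) <= f xP /\ f (iterate st) <= f xA.
Proof. by rewrite /st /select_better; case: ltP => /= h; split=> //; exact: ltW. Qed.

Lemma execution_step k : Om (iterate (s k)) -> Delta_min c <= Defs.radius (s k) ->
  [/\ Om (iterate (s k.+1)), Delta_min c <= Defs.radius (s k.+1)
    & f (iterate (s k.+1)) <= f (iterate (s k))].
Proof.
case: exec => _ /(_ k)[hP hA ->] Ox Dx.
case sk : (s k) hP hA Ox Dx => [st x D] /= hP hA Ox Dx.
have stay st' : [/\ Om (iterate (State st' x D)), Delta_min c <= Defs.radius (State st' x D)
    & f (iterate (State st' x D)) <= f x] by [].
case: st hP hA sk => // /(_ erefl)[Jx]; case: (oP k) => // xP DP lP hA sk.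
have [OP fP DP'] := lbtrs_success c_ok _ _ _ _ _ lP.
have OmP := OmegaJ_Omega _ _ (labels_at_labels _ _ Jx) OP.
case: eqP => [_|/eqP sp].
  by rewrite /select_better; case: ifP => _; split=> //; exact: ltW.
have [|Jh lA] := hA; first by split=> //; exists xP, DP.
case: (oA k) lA => [||xA DA|] // lA;
  try by rewrite /select_better; case: ifP => _; split=> //; exact: ltW.
have [OA fA DA'] := lbtrs_success c_ok _ _ _ _ _ lA.
have OmA := OmegaJ_Omega _ _ (labels_at_labels _ _ Jh) OA.
by rewrite /select_better; case: ifP => _; split=> //; exact: ltW.
Qed.

Lemma execution_invariant k : [/\ Om (iterate (s k)), Delta_min c <= Defs.radius (s k)
    & f (iterate (s k)) <= f x0].
Proof.
elim: k => [|k [Ok Dk fk]]; first by case: exec => -> _.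
have [Ok1 Dk1 fk1] := execution_step k Ok Dk.
by split=> //; exact: le_trans fk.
Qed.

Lemma execution_mono i j : (i <= j)%N -> f (iterate (s j)) <= f (iterate (s i)).
Proof.
move=> /subnK <-; elim: (j - i)%N => [//|l IH]; rewrite addSn.
have [Ok Dk _] := execution_invariant (l + i).
by have [_ _ /le_trans] := execution_step (l + i) Ok Dk; exact.
Qed.

Lemma nonstationary_decrease z : Om z -> ~ B_stationary f Om z ->
  exists2 J', J' \in labels_at z & exists2 e, 0 < e &
    \forall x \near z, forall delta0 o,
    Delta_min c <= delta0 -> lbtrs A a B b f c x J' delta0 o -> o <> Diverges ->
    exists x' delta, o = Success x' delta /\ f x' <= f x - e.
Proof.
move=> Oz nst; have [J' [y [Jz Jy gy]]] := nonstationary_branch f z Oz nst.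
exists J' => //; apply: lbtrs_decrease gy => //; exact: Omega_OmegaJ.
Qed.

(** A run returns only after [Zero] at a point without biactive pairs. At a non-stationary point
    some branch would force [Success], and by uniqueness it is the branch that was searched. *)
Lemma returned_stationary k : stat (s k) = Returned ->
  B_stationary f Om (iterate (s k)).
Proof.
elim: k => [|k IH]; first by case: exec => ->.
have [Ox Dx _] := execution_invariant k.
have [_ /(_ k)[hP _ sk1]] := exec.
case sk : (s k) IH sk1 hP Ox Dx => [[] x D] /= IH -> //.
move=> /(_ erefl)[Jx]; case: (oP k) => [||xP DP|] //= lP Ox Dx; last first.
  case: ifP => _; first by rewrite /select_better; case: ifP.
  by case: (oA k) => [||xA DA|] //=; rewrite /select_better; case: ifP.
case: eqP => //= nd _; apply: contrapT => nst.
have [J' J'x [e e0 /nbhs_singleton dec]] := nonstationary_decrease x Ox nst.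
have JJ' : J' = J k.
  by rewrite (labels_at_nondegenerate _ _ Ox nd J'x) (labels_at_nondegenerate _ _ Ox nd Jx).
by rewrite -JJ' in lP; have [//|x' [delta []]] := dec D Zero Dx lP.
Qed.

(** * Infinite runs and their cluster points *)

Section InfiniteRun.
Hypothesis run : forall k, stat (s k) = Running.
Local Notation x k := (iterate (s k)).

(** Failure or divergence of the primary search would stall the run. After a success, comparison
    with the auxiliary candidate can only lower [f] further. *)
Lemma primary_outcome k : J k \in labels_at (x k) /\
  lbtrs A a B b f c (x k) (J k) (Defs.radius (s k)) (oP k) /\
  ((oP k = Zero /\ x k.+1 = x k) \/
   exists xP DP, oP k = Success xP DP /\ f (x k.+1) <= f xP).
Proof.
have [_ /(_ k)[/(_ (run k))[Jk lk] _ sk1]] := exec.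
split=> //; split=> //.
have := run k.+1; rewrite sk1; have := run k.
case: (s k) => [st y D] /= ->.
case: (oP k) => [||xP DP|] //=; first by left.
right; exists xP, DP; split=> //; move: H.
case: ifP => _; first by case: (select_better_le xP y DP D).
case: (oA k) => [||xA DA|] // *; first [by case: (select_better_le xP y DP D)|
  by case: (select_better_le xP xA DP DA)].
Qed.

Lemma auxiliary_outcome k : auxiliary_performed tau (s k) (oP k) ->
  [/\ lbtrs A a B b f c (x k) (Jhat k) (Defs.radius (s k)) (oA k), oA k <> Diverges
    & forall xA DA, oA k = Success xA DA -> f (x k.+1) <= f xA].
Proof.
move=> perf; have [_ /(_ k)[_ /(_ perf)[Jk lk] sk1]] := exec.
have := run k.+1; rewrite sk1; case: perf => _ [xP [DP ->]].
have := run k.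
case: (s k) lk => [st y D] /= lk -> sp; rewrite (negbTE sp) => st1.
split=> //; first by move=> oD; rewrite oD in st1.
by move=> xA DA -> /=; case: (select_better_le xP xA DP DA).
Qed.

Variable z : 'cV[R]_n.
Hypothesis z_cluster : cluster ((fun k => x k) @ \oo) z.

Lemma cluster_infinitely_often V : nbhs z V ->
  forall k0, exists2 k, (k0 <= k)%N & V (x k).
Proof.
move=> zV k0.
have [_ [[k k0k <-] Vk]] : [set x k | k in [set k | (k0 <= k)%N]] `&` V !=set0.
  by apply: z_cluster => //; exists k0 => // k /= k0k; exists k.
by exists k.
Qed.

(** By monotonicity and continuity [f z] bounds all values from below, while some value is less than
    [f z + e]; one more drop by [e] would pass below [f z]. *)
Lemma no_repeated_decrease e : 0 < e ->
  ~ forall k0, exists2 k, (k0 <= k)%N & f (x k.+1) <= f (x k) - e.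
Proof.
move=> e0 dec.
have fc : {for z, continuous f} by exact: continuous_quadratic.
have lb k : f z <= f (x k).
  rewrite leNgt; apply/negP => lt.
  have [j kj] := cluster_infinitely_often _ (fc _ (lt_nbhsr lt)) k.
  by rewrite /= ltNge execution_mono.
have /(fc _) : nbhs (f z) [set y | y < f z + e].
  by apply: lt_nbhsl; rewrite ltrDl.
move=> /cluster_infinitely_often /(_ 0%N)[k _ /= fk].
have [j kj fj] := dec k.
have := lb j.+1; have := execution_mono _ _ kj; lra.
Qed.

Hypothesis level_compact : compact (Om `&` [set y | f y <= f x0]).

Lemma cluster_feasible : Om z.
Proof.
have /compact_closed cl := level_compact.
suff [] : (Om `&` [set y | f y <= f x0]) z by [].
apply: cl; first exact: norm_hausdorff.
move=> V /cluster_infinitely_often /(_ 0%N)[k _ Vk].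
by exists (x k); split=> //; have [] := execution_invariant k.
Qed.

(** Randomness enters the argument for a single path only through this hypothesis and the next; each
    holds almost surely, for all cubes and labels at once. *)
Hypothesis primary_draws : forall C J',
  (forall k0, exists2 k, (k0 <= k)%N &
    [/\ stat (s k) = Running, rational_cube C (x k) & J' \in labels_at (x k)]) ->
  forall k0, exists2 k, (k0 <= k)%N &
    [/\ stat (s k) = Running, rational_cube C (x k) & J k = J'].
Hypothesis auxiliary_draws : forall C J',
  (forall k0, exists2 k, (k0 <= k)%N &
    [/\ auxiliary_performed tau (s k) (oP k), rational_cube C (x k)
      & J' \in labels_at (threshold tau (x k))]) ->
  forall k0, exists2 k, (k0 <= k)%N &
    [/\ auxiliary_performed tau (s k) (oP k), rational_cube C (x k)
      & Jhat k = J'].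

Lemma cluster_stationary : B_stationary f Om z.
Proof.
have Oz := cluster_feasible.
apply: contrapT => nst.
have [J' J'z [e e0 dec]] := nonstationary_decrease z Oz nst.
have lab := near_labels_at J' z tau tau_gt0 Oz J'z.
have [C [Csub Cz]] := rational_cube_basis z _ (filterI dec lab).
have not_primary : ~ forall k0, exists2 k, (k0 <= k)%N &
    [/\ stat (s k) = Running, rational_cube C (x k) & J' \in labels_at (x k)].
  move=> /primary_draws io; apply: (no_repeated_decrease e e0) => k0.
  have [k k0k [_ Ck Jk]] := io k0; exists k => //.
  have [_ [lk out]] := primary_outcome k; rewrite Jk in lk.
  have [_ Dk _] := execution_invariant k.
  have [decx _] := Csub _ Ck.
  have [|x' [delta [oPk fx']]] := decx _ _ Dk lk.
    by case: out => [[-> _]|[? [? [-> _]]]].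
  case: out => [[]|[xP [DP [oPk' fk]]]]; first by rewrite oPk.
  by move: oPk' fk; rewrite oPk => -[<- _] fk; exact: le_trans fk _.
have not_auxiliary : ~ forall k0, exists2 k, (k0 <= k)%N &
    [/\ auxiliary_performed tau (s k) (oP k), rational_cube C (x k)
      & J' \in labels_at (threshold tau (x k))].
  move=> /auxiliary_draws io; apply: (no_repeated_decrease e e0) => k0.
  have [k k0k [perf Ck Jk]] := io k0; exists k => //.
  have [lk oD out] := auxiliary_outcome k perf; rewrite Jk in lk.
  have [_ Dk _] := execution_invariant k.
  have [decx _] := Csub _ Ck.
  have [x' [delta [oAk fx']]] := decx _ _ Dk lk oD.
  by apply: le_trans fx'; exact: out oAk.
have ev (S : nat -> Prop) : ~ (forall k0, exists2 k, (k0 <= k)%N & S k) ->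
    exists k0, forall k, (k0 <= k)%N -> ~ S k.
  move=> H; apply: contrapT => H'; apply: H => k0; apply: contrapT => H.
  by apply: H'; exists k0 => k k0k Sk; apply: H; exists k.
have [k1 nP] := ev _ not_primary; have [k2 nA] := ev _ not_auxiliary.
have [k k12 Ck] := cluster_infinitely_often _ Cz (maxn k1 k2).
(* While the iterate is in the cube, [J'] is not one of its labels, so some pair is small. A primary
   success would then trigger the auxiliary search, which no longer occurs there; hence the primary
   search returns [Zero] and the iterate stays put. *)
have stuck j : (k <= j)%N -> x j = x k.
  move=> /subnK <-; elim: (j - k)%N => [//|l IH]; rewrite addSn -IH.
  set i := (l + k)%N in IH *.
  have ki : (maxn k1 k2 <= i)%N by apply: leq_trans k12 _; exact: leq_addl.
  have Ci : rational_cube C (x i) by rewrite IH.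
  have [_ [labT labx]] := Csub _ Ci.
  have nlab : J' \notin labels_at (x i).
    by apply/negP => Ji; apply: (nP i) => //; exact: leq_trans (leq_maxl _ _) ki.
  have [_ [_ [[]//|[xP [DP [oPi _]]]]]] := primary_outcome i.
  case: (nA i); first exact: leq_trans (leq_maxr _ _) ki.
  split=> //; split=> //; first by exists xP, DP.
  by apply/eqP => /labx; apply/negP.
(* An eventually constant sequence clusters only at its constant value. *)
have xz : x k = z.
  apply: contrapT => /eqP xz.
  have d0 : 0 < `|z - x k| by rewrite normr_gt0 subr_eq0 eq_sym.
  have near_lt := @cvgr_dist_lt _ _ _ (nbhs z) (nbhs_filter z) id z cvg_id _ d0.
  by have [j kj] := cluster_infinitely_often _ near_lt k; rewrite /= stuck// ltxx.
apply: (nP k); first exact: leq_trans (leq_maxl _ _) k12.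
by split=> //; rewrite xz.
Qed.

End InfiniteRun.
End Execution.

(** * Measurability of cube events and almost sure stationarity *)

Lemma rational_cube_measurable {R : realType} {n : nat} {disp : measure_display}
    (Xi : measurableType disp)
    (F : set (set Xi)) (X : Xi -> 'cV[R]_n) C :
  sigma_algebra setT F ->
  (forall i, real_measurable_on F setT (fun w => X w i 0)) ->
  F [set w | rational_cube C (X w)].
Proof.
move=> sF mX; apply: (sigma_algebra_forall_countable sF) => i.
rewrite -[X in F X]setTI; apply: mX.
exact: measurable_realfun.measurable_ball.
Qed.

Theorem theorem3 (R : realType) (n0 m p r : nat) (m_ge1 : (1 <= m)%N)
  (A : 'M[R]_(p, n0 + (m + m))) (a : 'cV[R]_p)
  (B : 'M[R]_(r, n0 + (m + m))) (b : 'cV[R]_r)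
  (Q : 'M[R]_(n0 + (m + m))) (q : 'cV[R]_(n0 + (m + m))) (Q_sym : Q = Q^T)
  (c : tr_consts R) (c_ok : tr_consts_ok c) (tau : R) (tau_gt0 : 0 < tau)
  (x0 : 'cV[R]_(n0 + (m + m))) (x0_feasible : Omega A a B b x0)
  (Delta0 : R) (Delta0_ge : Delta_min c <= Delta0)
  (level_compact : compact
     (Omega A a B b `&` [set x | quadratic Q q x <= quadratic Q q x0]))
  (disp : measure_display) (Xi : measurableType disp) (P : probability Xi R)
  (FP FA : nat -> set (set Xi))
  (s : nat -> Xi -> tbta_state R (n0 + (m + m)))
  (J Jhat : nat -> Xi -> label m)
  (oP oA : nat -> Xi -> lbtrs_result R (n0 + (m + m)))
  (execution : forall w : Xi,
     tbta_execution A a B b (quadratic Q q) c tau x0 Delta0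
       (fun k => s k w) (fun k => J k w) (fun k => Jhat k w)
       (fun k => oP k w) (fun k => oA k w))
  (randomness : tbta_randomness P tau FP FA s J Jhat oP oA) :
  (forall (w : Xi) (k : nat), stat (s k w) = Returned ->
     B_stationary (quadratic Q q) (Omega A a B b) (iterate (s k w)))
  /\
  ((forall w : Xi, (forall k, stat (s k w) = Running) ->
      exists z, cluster ((fun k => iterate (s k w)) @ \oo) z)
   /\
   {ae P, forall w : Xi, (forall k, stat (s k w) = Running) ->
      forall z, cluster ((fun k => iterate (s k w)) @ \oo) z ->
        B_stationary (quadratic Q q) (Omega A a B b) z}).
Proof.
split; first by move=> w k; exact: returned_stationary (execution w) k.
have feas w k := execution_invariant c_ok x0_feasible Delta0_ge (execution w) k.
split.
  move=> w run.
  have [|z [_ zc]] := level_compact ((fun k => iterate (s k w)) @ \oo) _.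
    by exists 0%N => // k _ /=; have [] := feas w k.
  by exists z.
case: randomness => sFP sFA FPA FAP mFP mS mJ _ mJh _ uJ uJh.
have FPS k : FP k `<=` FP k.+1 by move=> E /FPA /FAP.
have FAS k : FA k `<=` FA k.+1 by move=> E /FAP /FPA.
have mFA k : FA k `<=` measurable by move=> E /FAP /mFP.
have mC k C : FP k [set w | rational_cube C (iterate (s k w))].
  by apply: rational_cube_measurable => //; case: (mS k).
(* Cubes and labels are paired into one countable index, so that the exceptional null sets can be
   united. *)
have primary (CJ : ('cV[rat]_(n0 + (m + m)) * nat) * label m) :=
  uniform_draws_infinitely_often P FP _ _
    (fun k => [set w | rational_cube CJ.1 (iterate (s k w))]) _ _ CJ.2
    sFP FPS mFP uJ (fun k t => FAP k _ (mJ k t)) (fun k => mC k CJ.1).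
(* The auxiliary draws are uniform given [FA k], so the same argument runs along that filtration,
   with the cube events lifted from [FP k]. *)
have auxiliary (CJ : ('cV[rat]_(n0 + (m + m)) * nat) * label m) :=
  uniform_draws_infinitely_often P FA _ _
    (fun k => [set w | rational_cube CJ.1 (iterate (s k w))]) _ _ CJ.2
    sFA FAS mFA uJh (fun k t => FPA k.+1 _ (mJh k t))
    (fun k => FPA k _ (mC k CJ.1)).
apply: filterS2 (ae_forall_countable _ _ _ primary) (ae_forall_countable _ _ _ auxiliary).
move=> w hP hA run z zc.
apply: (cluster_stationary Q_sym c_ok tau_gt0 x0_feasible
  Delta0_ge (execution w) run _ zc level_compact).
  by move=> C J'; exact: (hP (C, J')).
by move=> C J'; exact: (hA (C, J')).
Qed.
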